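(* Let $d\ge1$, $\kappa>0$, and let $V=aI_{d+1}+W$ with $a>0$ and $W$ a real skew-symmetric $(d+1)\times(d+1)$ matrix. Let $x_1(t),\dots,x_N(t)\in\mathbb S^d$, $t\ge 0$, be the solution of $$\dot x_j=\frac{\kappa}{N}\sum_{k=1}^N\big(Vx_k-\langle x_j,Vx_k\rangle x_j\big),\qquad x_j(0)=x_j^0\in\mathbb S^d,\qquad j=1,\dots,N,$$ where, for some $\ell\in\{1,\dots,N\}$, $x_j^0\ne x_N^0$ for $j=1,\dots,N-\ell$ and $x_j^0=x_N^0$ for $j=N-\ell+1,\dots,N$. Let $n,m\in\mathbb N$ with $n\le N$ be such that the $n$ points $x_1^0,\dots,x_n^0$ lie in an $m$-dimensional affine subspace of $\mathbb R^{d+1}$. Then for every $t\ge0$, the points $x_1(t),\dots,x_n(t)$ lie in some $m$-dimensional affine subspace of $\mathbb R^{d+1}$.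
   Context: $\mathbb S^d$ is the unit sphere in $\mathbb R^{d+1}$ with Euclidean inner product $\langle\cdot,\cdot\rangle$. The affine subspace is allowed to depend on $t$. $\mathbb N$ denotes the positive integers. *)

(* Defs.v *)
From HB Require Import structures.
From mathcomp Require Import all_boot all_order all_algebra.
From mathcomp Require Import all_classical all_reals all_analysis.
Set Implicit Arguments.
Unset Strict Implicit.
Unset Printing Implicit Defensive.
Import Order.TTheory GRing.Theory Num.Theory.
Import numFieldNormedType.Exports.
Local Open Scope classical_set_scope.
Local Open Scope ring_scope.

Definition dot (R : realType) (n : nat) (u v : 'cV[R]_n) : R :=
  \sum_(i < n) u i 0 * v i 0.

(* The norm that the library puts on matrices is the sup norm, so the Euclidean
   sphere is written with [dot]. *)
Definition sphere (R : realType) (d : nat) : set 'cV[R]_d.+1 :=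
  [set x | dot x x = 1].

Definition vector_field (R : realType) (d N : nat) (kappa : R)
    (V : 'M[R]_d.+1) (x : 'I_N -> 'cV[R]_d.+1) (j : 'I_N) : 'cV[R]_d.+1 :=
  (kappa / N%:R) *: \sum_(k < N) (V *m x k - dot (x j) (V *m x k) *: x j).

(* Only the values at times t >= 0 matter: the derivative at the endpoint t = 0
   is the right derivative. *)
Definition is_solution (R : realType) (d N : nat) (kappa : R)
    (V : 'M[R]_d.+1) (x0 : 'I_N -> 'cV[R]_d.+1)
    (x : 'I_N -> R -> 'cV[R]_d.+1) : Prop :=
  [/\ forall j, x j 0 = x0 j,
      forall (j : 'I_N) (t : R), 0 <= t -> sphere (x j t),
      forall j : 'I_N, h^-1 *: (x j h - x j 0) @[h --> 0^'+] -->
        vector_field kappa V (fun k => x k 0) j &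
      forall (j : 'I_N) (t : R), 0 < t ->
        is_derive t 1 (x j) (vector_field kappa V (fun k => x k t) j)].

Definition affine_subspace (R : realType) (d m : nat)
    (A : set 'cV[R]_d.+1) : Prop :=
  exists (p : 'cV[R]_d.+1) (U : {vspace 'cV[R]_d.+1}),
    \dim U = m /\ A = [set y | y - p \in U].

(* Main.v *)
(* With the common drive c = (kappa / N) sum_k V x_k the equation reads
   x_j' = c - <c, x_j> x_j.  If lam_j' = <c, x_j> lam_j, then the lift
   lam_j (x_j, 1) in R^(d+2) solves the linear equation z' = mu c,
   mu' = <c, z>, which is the same for all j.  By uniqueness, every linear
   relation between the lifts at time 0 persists, so the rank of the points
   (x_j(t), 1), j <= n, that is, one plus the dimension of the affine hull, does
   not increase. *)

Require Import Defs.
From HB Require Import structures.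
From mathcomp Require Import all_boot all_order all_algebra.
From mathcomp Require Import all_classical all_reals all_analysis.
From mathcomp Require Import ring lra.
Set Implicit Arguments.
Unset Strict Implicit.
Unset Printing Implicit Defensive.
Import Order.TTheory GRing.Theory Num.Theory.
Import numFieldNormedType.Exports.
Local Open Scope classical_set_scope.
Local Open Scope ring_scope.

(** * Uniqueness for the lifted linear equation *)

(** Bounded coefficients make the derivative of [mu^2 + |z|^2] at most a constant multiple of
    itself. Continuity at 0 carries the monotonicity obtained for t > 0 back to the initial time. *)
Lemma linear_ode_eq0 (R : realType) (p : nat) (c z : 'I_p -> R -> R)
    (mu : R -> R) (K : R) :
  0 <= K -> (forall i (t : R), 0 < t -> `|c i t| <= K) ->
  (forall i (t : R), 0 <= t -> {for t, continuous (z i)}) ->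
  (forall t : R, 0 <= t -> {for t, continuous mu}) ->
  (forall i (t : R), 0 < t -> is_derive t 1 (z i) (mu t * c i t)) ->
  (forall t : R, 0 < t -> is_derive t 1 mu (\sum_i c i t * z i t)) ->
  (forall i, z i 0 = 0) -> mu 0 = 0 ->
  forall t : R, 0 <= t -> (forall i, z i t = 0) /\ mu t = 0.
Proof.
move=> K0 cK zc muc dz dmu z0 mu0.
(* Gronwall: exp(-L t) (mu^2 + |z|^2) is nonincreasing and vanishes at 0. *)
pose L := 2 * K * p.+1%:R.
pose G : R -> R := mu ^+ 2 + \sum_(i < p) z i ^+ 2.
have GE (s : R) : G s = mu s ^+ 2 + \sum_(i < p) z i s ^+ 2.
  by rewrite /G /= fctE fct_sumE.
pose F : R -> R := (expR \o ( *%R (- L))) * G.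
have FE (s : R) : F s = expR (- L * s) * G s by [].
have dF (t : R) : 0 < t -> is_derive t 1 F
    (expR (- L * t) * (4 * (mu t * \sum_i c i t * z i t) - L * G t)).
  move=> t0.
  have ? := dmu t t0; have ? := fun i => dz i t t0.
  have dG : is_derive t 1 G (4 * (mu t * \sum_i c i t * z i t)).
    apply: is_derive_eq.
    rewrite mulr_sumr mulr_sumr scaler_sumr -big_split /=.
    by apply: eq_bigr => i _; rewrite /GRing.scale /=; ring.
  have dE : is_derive t 1 (expR \o ( *%R (- L))) (expR (- L * t) * (- L)).
    apply: is_derive1_comp.
    by apply: is_derive_eq; rewrite /GRing.scale /=; ring.
  by apply: is_derive_eq; rewrite /GRing.scale /=; ring.
have cF (s : R) : 0 <= s -> {for s, continuous F}.
  move=> s0; apply: continuousM.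
    apply: continuous_comp; last exact: continuous_expR.
    exact: mulrl_continuous.
  have -> : G = (fun s => mu s * mu s + \sum_(i < p) z i s * z i s).
    by apply/funext => r; rewrite GE; under eq_bigr do rewrite expr2.
  apply: cvgD; first by apply: cvgM; exact: muc.
  by apply: cvg_big => [|i _]; [exact: add_continuous|apply: cvgM; exact: zc].
have dF0 (t : R) : 0 < t ->
    expR (- L * t) * (4 * (mu t * \sum_i c i t * z i t) - L * G t) <= 0.
  move=> t0; rewrite pmulr_rle0 ?expR_gt0// subr_le0 GE.
  (* Termwise [4 mu c_i z_i <= 2 K (mu^2 + z_i^2)]. Summing counts [mu^2] p times, whence the factor
     p + 1 in [L]. *)
  apply: (@le_trans _ _ (\sum_(i < p) 2 * K * (mu t ^+ 2 + z i t ^+ 2))).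
    rewrite !mulr_sumr; apply: ler_sum => i _.
    have := cK i t t0; rewrite ler_norml => /andP[h1 h2].
    have := sqr_ge0 (mu t + z i t); have := sqr_ge0 (mu t - z i t).
    nra.
  rewrite -mulr_sumr big_split /= sumr_const card_ord /L -[leRHS]mulrA.
  rewrite ler_wpM2l ?mulr_ge0// -natr1 mulrDl mul1r mulrDr.
  rewrite -[_ *+ p]mulr_natl; set S := \sum_(i < p) _; rewrite -subr_ge0.
  rewrite [leRHS](_ : _ = p%:R * S + mu t ^+ 2); last by ring.
  by rewrite addr_ge0 ?sqr_ge0// mulr_ge0// sumr_ge0// => i _; exact: sqr_ge0.
move=> t t0.
have : F t <= F 0.
  clearbody F; apply: (ler0_derive1_nincry _ _ _ (lexx 0) t0).
  - by move=> r; rewrite in_itv/= andbT => /dF r0; exact: ex_derive.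
  - move=> r; rewrite in_itv/= andbT => r0; rewrite derive1E.
    by rewrite (@derive_val _ _ _ _ _ _ _ (dF r r0)); exact: dF0.
  - apply: continuous_in_subspaceT => r; rewrite inE/= in_itv/= andbT.
    exact: cF.
have -> : F 0 = 0.
  rewrite FE GE mu0 expr0n add0r big1 ?mulr0// => i _.
  by rewrite z0 expr0n.
rewrite FE GE.
rewrite pmulr_rle0 ?expR_gt0// => h.
have hs : 0 <= \sum_(i < p) z i t ^+ 2 by apply: sumr_ge0 => i _; exact: sqr_ge0.
have hm := sqr_ge0 (mu t).
split; last by apply/eqP; rewrite -sqrf_eq0; apply/eqP; lra.
have /eqP : \sum_(i < p) z i t ^+ 2 = 0 by lra.
rewrite psumr_eq0; last by move=> i _; exact: sqr_ge0.
move=> /allP hz i; apply/eqP; rewrite -sqrf_eq0.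
exact: hz (mem_index_enum i).
Qed.

(** * Antiderivatives and extension to negative times *)

Lemma antiderivative (R : realType) (f : R -> R) : continuous f ->
  exists F : R -> R, forall t : R, 0 <= t -> is_derive t 1 F (f t).
Proof.
move=> cf.
(* Any negative lower bound gives a two-sided derivative at 0 as well. *)
exists (fun t => (\int[lebesgue_measure]_(s in `[-1, t]) f s)).
move=> t t0.
have tt : t < t + 1 by rewrite ltrDl.
have ti : -1 < t by rewrite (lt_le_trans _ t0)// ltrN10.
have [|dF eF] := continuous_FTC1_closed tt _ ti (cf t).
  apply: continuous_compact_integrable; first exact: segment_compact.
  exact: continuous_subspaceT.
by apply: DeriveDef dF _; rewrite -derive1E eF.
Qed.

(** Lets data given only for t >= 0 meet the global continuity that [antiderivative] asks for. *)
Lemma continuous_max0 (R : realType) (f : R -> R) :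
  (forall t : R, 0 < t -> {for t, continuous f}) ->
  f h @[h --> 0^'+] --> f 0 -> continuous (fun s : R => f (Num.max s 0)).
Proof.
move=> cf f0; set g := fun s : R => _; move=> s.
have [s0|s0|->] := ltgtP s 0; rewrite /continuous_at {2}/g.
- apply: cvg_near_cst; near=> r; congr f.
  rewrite (max_r (ltW s0)) max_r//; apply/ltW.
  by near: r; exact: lt_nbhsl.
- rewrite (max_l (ltW s0)).
  apply: cvg_trans (cf s s0).
  apply: near_eq_cvg; near=> r; rewrite /g max_l//; apply/ltW.
  by near: r; exact: lt_nbhsr.
- apply/(left_right_continuousP g); rewrite {2 4}/g maxxx; split.
    apply: cvg_near_cst; near=> r.
    have r0 : r <= 0 by apply/ltW; near: r; exact: nbhs_left_lt.
    by rewrite /g max_r.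
  apply: cvg_trans f0; apply: near_eq_cvg; near=> r.
  have r0 : 0 <= r by apply/ltW; near: r; exact: nbhs_right_gt.
  by rewrite /g max_l.
Unshelve. all: by end_near. Qed.

(** * Dimension and linear relations *)

(** Relations only bound the dimension from above, while the theorem asks for exactly m. Each
    induction step adds a line outside the current subspace. *)
Lemma vspace_extend (K : fieldType) (vT : vectType K) (U : {vspace vT}) m :
  (\dim U <= m <= \dim {:vT})%N ->
  exists U' : {vspace vT}, (U <= U')%VS /\ \dim U' = m.
Proof.
elim: m => [|m IH].
  by rewrite leqn0 => /andP[/eqP U0 _]; exists U.
rewrite leq_eqVlt => /andP[/orP[/eqP <- _|]]; first by exists U.
rewrite ltnS => Um mT.
have [|U1 [UU1 dU1]] := IH; first by rewrite Um ltnW.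
have : (~~ (fullv <= U1)%VS) by apply: contraL mT => /dimvS; rewrite -leqNgt dU1.
case/subvPn => v _ vU1.
exists (U1 + <[v]>)%VS; split; first exact: subv_trans UU1 (addvSl _ _).
have v0 : v != 0 by apply: contraNneq vU1 => ->; exact: mem0v.
rewrite dimv_disjoint_sum ?dU1 ?dim_vline ?v0 ?addn1//.
apply/eqP; rewrite -subv0; apply/subvP => w; rewrite memv_cap => /andP[wU].
case/vlineP => k wk; rewrite memv0; move: wU; rewrite wk.
have [-> _|k0] := eqVneq k 0; first by rewrite scale0r.
by rewrite rpredZeq (negPf vU1) (negPf k0).
Qed.

Section linear_combination.
Variables (K : fieldType) (vT : vectType K) (n : nat).

(** As a linear map in [u], its kernel is the space of relations among the [X j] and its image is
    their span. *)
Definition lincomb (X : 'I_n -> vT) (u : 'rV[K]_n) := \sum_j u 0 j *: X j.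

Fact lincomb_is_linear X : linear (lincomb X).
Proof.
move=> k u v; rewrite /lincomb scaler_sumr -big_split /=.
by apply: eq_bigr => j _; rewrite !mxE scalerDl scalerA.
Qed.

HB.instance Definition _ X :=
  GRing.isLinear.Build K 'rV[K]_n vT _ (lincomb X) (lincomb_is_linear X).

(** Rank-nullity: both maps start from the same space, so the larger kernel has the smaller
    image. *)
Lemma dim_le_of_relations (X Y : 'I_n -> vT) (U : {vspace vT}) :
  (forall j, X j \in U) ->
  (forall u : 'I_n -> K, \sum_j u j *: X j = 0 -> \sum_j u j *: Y j = 0) ->
  exists U' : {vspace vT}, (\dim U' <= \dim U)%N /\ forall j, Y j \in U'.
Proof.
move=> XU XY; exists (limg (linfun (lincomb Y))); split; last first.
  move=> j; apply/memv_imgP; exists (delta_mx 0 j); first exact: memvf.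
  rewrite lfunE /= /lincomb (bigD1 j)//= mxE !eqxx scale1r big1 ?addr0//.
  by move=> k kj; rewrite mxE (negPf kj) andbF scale0r.
have kXY : (lker (linfun (lincomb X)) <= lker (linfun (lincomb Y)))%VS.
  apply/subvP => u; rewrite !memv_ker !lfunE /= => /eqP h.
  by apply/eqP/XY.
have XimgU : (limg (linfun (lincomb X)) <= U)%VS.
  apply/subvP => _ /memv_imgP[u _ ->]; rewrite lfunE /=.
  by apply: memv_suml => j _; exact: memvZ.
apply: leq_trans (dimvS XimgU).
have := limg_ker_dim (linfun (lincomb X)) fullv.
have := limg_ker_dim (linfun (lincomb Y)) fullv.
rewrite !capfv => <- hX; have := dimvS kXY.
by rewrite -(leq_add2r (\dim (limg (linfun (lincomb Y))))) -hX leq_add2l.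
Qed.

End linear_combination.

(** * Persistence of affine relations along the flow *)

(** The weights are exponentials of antiderivatives of [<c, x_j>]. They are chosen before [alpha],
    so one family serves all relations at once. *)
Lemma affine_relation_flow (R : realType) (d p : nat) (K : R)
    (c : 'I_d -> R -> R) (x : 'I_p -> 'I_d -> R -> R) :
  0 <= K -> (forall i (t : R), 0 < t -> `|c i t| <= K) ->
  (forall i, continuous (c i)) -> (forall j i, continuous (x j i)) ->
  (forall j i (t : R), 0 < t ->
    is_derive t 1 (x j i) (c i t - (\sum_k c k t * x j k t) * x j i t)) ->
  exists lam : 'I_p -> R -> R, (forall j t, 0 < lam j t) /\
    forall alpha : 'I_p -> R,
      \sum_j alpha j * lam j 0 = 0 ->
      (forall i, \sum_j alpha j * lam j 0 * x j i 0 = 0) ->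
      forall t : R, 0 <= t ->
        \sum_j alpha j * lam j t = 0 /\
        forall i, \sum_j alpha j * lam j t * x j i t = 0.
Proof.
move=> K0 cK cc cx dx.
have fc j : continuous (fun t : R => \sum_k c k t * x j k t).
  move=> t; apply: cvg_big => [|k _]; first exact: add_continuous.
  by apply: cvgM; [exact: cc|exact: cx].
have /choice[L dL] j := antiderivative (fc j).
pose lam j := expR \o L j.
have dlam j (t : R) : 0 <= t ->
    is_derive t 1 (lam j) (lam j t * \sum_k c k t * x j k t).
  by move=> t0; apply: is_derive1_comp; exact: dL.
exists lam; split; first by move=> j t; exact: expR_gt0.
move=> alpha mu0 z0.
pose mu : R -> R := \sum_j (alpha j *: lam j).
pose z i : R -> R := \sum_j (alpha j *: (lam j * x j i)).
have muE t : mu t = \sum_j alpha j * lam j t by rewrite /mu fct_sumE.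
have zE i t : z i t = \sum_j alpha j * lam j t * x j i t.
  by rewrite /z fct_sumE; apply: eq_bigr => j _; rewrite -mulrA.
have lamc j (t : R) : 0 <= t -> {for t, continuous (lam j)}.
  move=> /(dlam j) dl; apply/differentiable_continuous/derivable1_diffP.
  exact: ex_derive.
move=> t t0.
have [||||||zt0 mut0] := @linear_ode_eq0 R d c z mu K K0 cK _ _ _ _ _ _ t t0.
- move=> i s s0.
  rewrite (_ : z i = fun s => \sum_j alpha j * (lam j s * x j i s)); last first.
    by apply/funext => r; rewrite zE; under eq_bigr do rewrite -mulrA.
  apply: cvg_big => [|j _]; first exact: add_continuous.
  apply: cvgM; first exact: cvg_cst.
  by apply: cvgM; [exact: lamc|exact: cx].
- move=> s s0; rewrite (_ : mu = fun s => \sum_j alpha j * lam j s); last first.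
    by apply/funext.
  apply: cvg_big => [|j _]; first exact: add_continuous.
  by apply: cvgM; [exact: cvg_cst|exact: lamc].
(* The quadratic terms cancel: [(lam_j x_j)' = lam_j <c, x_j> x_j + lam_j (c - <c, x_j> x_j) = lam_j
   c]. *)
- move=> i s s0; have dl j := dlam j s (ltW s0); have dxs j := dx j i s s0.
  apply: is_derive_eq; rewrite muE mulr_suml; apply: eq_bigr => j _.
  by rewrite /GRing.scale /=; ring.
- move=> s s0; have dl j := dlam j s (ltW s0).
  apply: is_derive_eq.
  under [RHS]eq_bigr do rewrite zE mulr_sumr.
  rewrite exchange_big /=; apply: eq_bigr => j _.
  by rewrite /GRing.scale /= !mulr_sumr; apply: eq_bigr => k _; ring.
- by move=> i; rewrite zE.
- by rewrite muE.
by split=> [|i]; rewrite -?muE -?zE ?zt0.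
Qed.

(** * Application to the given system *)

Section solution.
Variables (R : realType) (d N : nat) (kappa : R) (V : 'M[R]_d.+1).
Variables (x0 : 'I_N -> 'cV[R]_d.+1) (x : 'I_N -> R -> 'cV[R]_d.+1).
Hypothesis hx : is_solution kappa V x0 x.

(* Freezing the solution before time 0 makes it continuous on the whole line. *)
Let coord j i (s : R) : R := x j (Num.max s 0) i 0.

Let drive i (s : R) : R :=
  \sum_(k < N) kappa / N%:R * \sum_l V i l * coord k l s.

Lemma sphere_coord_le1 (u : 'cV[R]_d.+1) i : sphere u -> `|u i 0| <= 1.
Proof.
rewrite /sphere /= /dot => u1.
have : u i 0 * u i 0 <= 1.
  rewrite -u1 (bigD1 i)//= lerDl sumr_ge0// => k _.
  by rewrite -expr2 sqr_ge0.
by rewrite -expr2 -real_normK ?num_real// expr_le1.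
Qed.

Lemma solution_coord_continuous j i : continuous (coord j i).
Proof.
have [_ _ hx0 dx] := hx.
apply: (@continuous_max0 R (fun s => x j s i 0)) => [t t0|].
  have cxt : {for t, continuous (x j)}.
    apply/differentiable_continuous/derivable1_diffP.
    by have := dx j t t0 => ?; exact: ex_derive.
  exact: (@continuous_comp _ _ _ (x j) (fun M : 'cV[R]_d.+1 => M i 0) t cxt
    (@coord_continuous _ _ _ i 0 (x j t))).
apply: (@cvg_comp _ _ _ (x j) (fun M : 'cV[R]_d.+1 => M i 0) _ (nbhs (x j 0)));
  last exact: coord_continuous.
have h0 : h @[h --> (0:R)^'+] --> (0 : R).
  exact: cvg_at_right_filter cvg_id.
(* Right continuity at 0 follows from the right derivative, since h times a convergent quotient
   tends to 0. *)
have hc : x j 0 + h *: (h^-1 *: (x j h - x j 0)) @[h --> (0:R)^'+] --> x j 0.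
  rewrite -[X in _ --> X]addr0 -(scale0r (vector_field kappa V (x^~ 0) j)).
  by apply: cvgD; [exact: cvg_cst|apply: cvgZ; [exact: h0|exact: hx0]].
have xE : \forall h \near (0:R)^'+,
    x j 0 + h *: (h^-1 *: (x j h - x j 0)) = x j h.
  near=> h; have h_neq0 : h != 0.
    by apply: lt0r_neq0; near: h; exact: nbhs_right_gt.
  by rewrite /= scalerA divff// scale1r addrC subrK.
by apply: cvg_trans hc; exact: near_eq_cvg xE.
Unshelve. all: by end_near. Qed.

Lemma vector_field_coord j i (t : R) : 0 < t ->
  vector_field kappa V (fun k => x k t) j i 0 =
  drive i t - (\sum_k drive k t * coord j k t) * coord j i t.
Proof.
move=> t0; rewrite /drive /coord max_l ?ltW// /vector_field.
rewrite mxE summxE mulr_sumr.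
under eq_bigr do rewrite !mxE mulrBr.
rewrite sumrB; congr (_ - _).
under [in RHS]eq_bigr do rewrite mulr_suml.
rewrite exchange_big mulr_suml /=; apply: eq_bigr => k _.
rewrite /dot mulrA; congr (_ * _); rewrite mulr_sumr.
by apply: eq_bigr => l _; rewrite mxE; ring.
Qed.

Lemma solution_affine_relation (p : nat) (w : 'I_p -> 'I_N) :
  exists lam : 'I_p -> R -> R, (forall j t, 0 < lam j t) /\
    forall alpha : 'I_p -> R,
      \sum_j alpha j * lam j 0 = 0 ->
      \sum_j (alpha j * lam j 0) *: x0 (w j) = 0 ->
      forall t : R, 0 <= t ->
        \sum_j alpha j * lam j t = 0 /\
        \sum_j (alpha j * lam j t) *: x (w j) t = 0.
Proof.
have [x00 xS _ dx] := hx.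
(* Points of the sphere have coordinates of modulus at most 1; summing over i as well gives one
   bound for all coordinates of the drive. *)
pose K := \sum_i \sum_(k < N) `|kappa / N%:R| * \sum_l `|V i l|.
have cK i (t : R) : 0 < t -> `|drive i t| <= K.
  move=> t0; rewrite /K (bigD1 i)//= ler_wpDr//.
    by apply: sumr_ge0 => k _; apply: sumr_ge0 => l _; rewrite mulr_ge0 ?sumr_ge0.
  apply: le_trans (ler_norm_sum _ _ _) _; apply: ler_sum => k _.
  rewrite normrM ler_wpM2l//.
  apply: le_trans (ler_norm_sum _ _ _) _; apply: ler_sum => l _.
  rewrite normrM ler_piMr//; apply: sphere_coord_le1.
  by rewrite /coord max_l ?ltW//; apply/xS/ltW.
have cc i : continuous (drive i).
  move=> t; apply: cvg_big => [|k _]; first exact: add_continuous.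
  apply: cvgM; first exact: cvg_cst.
  apply: cvg_big => [|l _]; first exact: add_continuous.
  by apply: cvgM; [exact: cvg_cst|exact: solution_coord_continuous].
have dcoord j i (t : R) : 0 < t -> is_derive t 1 (coord j i)
    (drive i t - (\sum_k drive k t * coord j k t) * coord j i t).
  move=> t0; rewrite -vector_field_coord//.
  have [dxt ext] := dx j t t0.
  apply: (@near_eq_is_derive _ _ _ (fun s => x j s i 0)).
    near=> s; rewrite /coord max_l//; apply/ltW.
    by near: s; exact: lt_nbhsr.
  apply: DeriveDef; first exact: (derivable_mxP _ _ _).1.
  by rewrite -ext derive_mx// mxE.
have K0 : 0 <= K.
  by apply: sumr_ge0 => i _; apply: sumr_ge0 => k _; rewrite mulr_ge0 ?sumr_ge0.
have [lam [lam0 hlam]] := @affine_relation_flow R d.+1 p K drive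
  (fun j => coord (w j)) K0 cK cc
  (fun j => @solution_coord_continuous (w j)) (fun j => dcoord (w j)).
exists lam; split => // alpha h1 h2 t t0.
have coordE j i (s : R) : 0 <= s -> coord j i s = x j s i 0.
  by move=> s0; rewrite /coord max_l.
have [||h3 h4] := hlam alpha _ _ t t0 => //.
  move=> i; have /matrixP/(_ i 0) := h2; rewrite summxE mxE => e.
  by apply: etrans e; apply: eq_bigr => j _; rewrite mxE coordE// x00.
split => //; apply/colP => i; rewrite summxE [RHS]mxE.
by apply: etrans (h4 i); apply: eq_bigr => j _; rewrite mxE coordE.
Unshelve. all: by end_near. Qed.

End solution.

(* Indices are shifted by one: the ordinal j : 'I_N stands for the index j + 1,
   so [jN] is the index N. *)
Theorem proposition4p4 (R : realType) (d : nat) (hd : (1 <= d)%N)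
  (kappa : R) (hkappa : 0 < kappa)
  (a : R) (ha : 0 < a)
  (W : 'M[R]_d.+1) (hW : W^T = - W)
  (V : 'M[R]_d.+1) (hV : V = a%:M + W)
  (N : nat) (jN : 'I_N) (hjN : jN = N.-1 :> nat)
  (x0 : 'I_N -> 'cV[R]_d.+1) (hx0 : forall j, sphere (x0 j))
  (l : nat) (hl : (1 <= l <= N)%N)
  (hx0_ne : forall j : 'I_N, (j < N - l)%N -> x0 j <> x0 jN)
  (hx0_eq : forall j : 'I_N, (N - l <= j)%N -> x0 j = x0 jN)
  (x : 'I_N -> R -> 'cV[R]_d.+1) (hx : is_solution kappa V x0 x)
  (n m : nat) (hn : (1 <= n <= N)%N) (hm : (1 <= m)%N)
  (hplane : exists A : set 'cV[R]_d.+1,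
     affine_subspace m A /\ forall j : 'I_N, (j < n)%N -> A (x0 j)) :
  forall t : R, 0 <= t ->
    exists A : set 'cV[R]_d.+1,
      affine_subspace m A /\ forall j : 'I_N, (j < n)%N -> A (x j t).
Proof.
move=> t t0; have [A [[q [U [dimU ->]]] Ax0]] := hplane.
case/andP: hn => n0 nN.
pose w : 'I_n -> 'I_N := widen_ord nN; have i0 : 'I_n := Ordinal n0.
have [lam [lam0 hlam]] := solution_affine_relation hx w.
have lamn0 j s : lam j s != 0 by rewrite gt_eqF.
(* The factor by which a coefficient of an affine relation changes between times 0 and t. *)
pose om j := lam j t / lam j 0.
have XU j : x0 (w j) - x0 (w i0) \in U.
  have -> : x0 (w j) - x0 (w i0) = (x0 (w j) - q) - (x0 (w i0) - q).
    by rewrite opprB addrA subrK.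
  by apply: rpredB; [exact: Ax0 (w j) (ltn_ord j)|exact: Ax0 (w i0) (ltn_ord i0)].
have [u hu|U1 [dimU1 YU1]] := dim_le_of_relations
    (Y := fun j => om j *: (x (w j) t - x (w i0) t)) XU.
  (* A relation among differences from the base point [i0] becomes an affine one once the total
     weight is subtracted at [i0]; dividing by [lam j 0] offsets the initial weight. *)
  pose al j := (u j - (j == i0)%:R * \sum_k u k) / lam j 0.
  have alE j : al j * lam j 0 = u j - (j == i0)%:R * \sum_k u k.
    by rewrite /al divfK.
  have delta (M : lmodType R) (F : 'I_n -> M) (s : R) :
      \sum_j ((j == i0)%:R * s) *: F j = s *: F i0.
    rewrite (bigD1 i0)//= eqxx mul1r big1 ?addr0// => j /negPf ->.
    by rewrite mul0r scale0r.
  have delta1 (s : R) : \sum_j (j == i0)%:R * s = s.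
    rewrite (bigD1 i0)//= eqxx mul1r big1 ?addr0// => j /negPf ->.
    by rewrite mul0r.
  have sum0 : \sum_j al j * lam j 0 = 0.
    under eq_bigr do rewrite alE.
    by rewrite sumrB delta1 subrr.
  have comb0 : \sum_j (al j * lam j 0) *: x0 (w j) = 0.
    under eq_bigr do rewrite alE scalerBl.
    rewrite sumrB delta; move: hu.
    by under eq_bigr do rewrite scalerBr; rewrite sumrB -scaler_suml.
  have [s1 s2] := hlam al sum0 comb0 t t0.
  (* The correction at [i0] is invisible here, because it multiplies a zero difference. *)
  transitivity (\sum_j (al j * lam j t) *: (x (w j) t - x (w i0) t)).
    apply: eq_bigr => j _; rewrite scalerA; have [->|ji0] := eqVneq j i0.
      by rewrite subrr !scaler0.
    by congr (_ *: _); rewrite /al (negPf ji0) mul0r subr0 /om mulrCA mulrC.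
  under eq_bigr do rewrite scalerBr.
  by rewrite sumrB s2 -scaler_suml s1 scale0r subrr.
(* There is room for dimension m, because [U] itself has it. *)
have [|U2 [U12 dimU2]] := @vspace_extend _ _ U1 m.
  by rewrite -{1}dimU dimU1 -dimU dimvS// subvf.
exists [set y | y - x (w i0) t \in U2]; split; first by exists (x (w i0) t), U2.
move=> j jn /=; apply: (subvP U12).
(* The weights never vanish, so the factor [om] can be removed from the membership. *)
have := YU1 (Ordinal jn); rewrite rpredZeq /om mulf_eq0 invr_eq0 !(negPf (lamn0 _ _)) /=.
by rewrite (_ : w (Ordinal jn) = j)//; exact: val_inj.
Qed.
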